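(* Let $X$ be a regular strong Choquet space, $\Gamma$ a group of homeomorphisms of $X$, and $Y\subseteq X$ a $\Gamma$-invariant set. Let $\mathcal{U}$ be the family of open sets $U\subseteq X$ for which there is no finite set $\Delta\subseteq\Gamma$ such that $Y\subseteq\Delta\cdot U$. Let $\langle R_n\mid n\in\mathbb{N}\rangle$ be an increasing sequence of reflexive symmetric closed subsets of $X\times X$. Suppose there is a compact $\mathcal{I}_{\mathcal{U}}$-positive set $K\subseteq X$ such that: (a) for all $n\in\mathbb{N}$ and all $x\in K$ there is $\gamma\in\Gamma$ such that $(x,\gamma\cdot x)\notin R_n^{(2)}$; (b) for all $\gamma\in\Gamma$ there is $n\in\mathbb{N}$ such that for all $x\in K$, $(x,\gamma\cdot x)\in R_n$; (c) for all $\gamma\in\Gamma$, all $x,y\in\Gamma\cdot K$ and all $n\in\mathbb{N}$, if $x\mathrel{R_n}y$ then $\gamma\cdot x\mathrel{R_n}\gamma\cdot y$. Then there is a map $\phi:2^\omega\to\mathcal{P}(X)$ such that for all $y,z\in2^\omega$: - $\phi(y)$ is a nonempty closed $G_\delta$ subset of $X$; - if $z\mathrel{\mathbb{E}_0}y$ then there is $\gamma\in\Gamma$ such that $\gamma\cdot\phi(z)=\phi(y)$; - if $\neg(z\mathrel{\mathbb{E}_0}y)$ then $\phi(y)\times\phi(z)\subseteq{\sim}\bigcup_{n\in\mathbb{N}}R_n$. In particular, there is a map $\phi':2^\omega\to X$ which is a homomorphism from $(\mathbb{E}_0,{\sim}\mathbb{E}_0)$ to $(E_\Gamma^X,{\sim}\bigcup_{n\in\mathbb{N}}R_n)$;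 that is, for all $c,d\in2^\omega$, $c\mathrel{\mathbb{E}_0}d$ implies $\phi'(c)\mathrel{E_\Gamma^X}\phi'(d)$, and $\neg(c\mathrel{\mathbb{E}_0}d)$ implies $(\phi'(c),\phi'(d))\notin\bigcup_{n}R_n$. Moreover, if $X$ is compact, then the homomorphism $\phi'$ can be chosen to take values in $\overline{\Gamma\cdot x}$ for some $x\in K$.
   Context: The strong Choquet game on a topological space $X$: in round $n<\omega$, player A chooses an open set $U_n\subseteq V_{n-1}$ (where $V_{-1}=X$) and a point $x_n\in U_n$, and player B responds with an open set $V_n\subseteq U_n$ containing $x_n$. Player B wins if $\bigcap_{n<\omega}V_n\neq\emptyset$. $X$ is strong Choquet if player B has a winning strategy. For a family $\mathcal{U}$ of open subsets of a topological space $X$, $\mathcal{I}_{\mathcal{U}}$ is the family of sets $F\subseteq X$ such that for every $U\in\mathcal{U}$ there is an open $V\supseteq F$ with $V\cup U\in\mathcal{U}$. A set $F\subseteq X$ is $\mathcal{I}_{\mathcal{U}}$-positive if $F\notin\mathcal{I}_{\mathcal{U}}$. $\Delta\cdot U=\bigcup_{\delta\in\Delta}\delta\cdot U$ (similarly $\Gamma\cdot K$, $\Gamma\cdot x$). $\overline{Z}$ is closure, ${\sim}Z$ is complement, $\mathcal{P}(X)$ is the power set. $R^{(k)}$ is the $k$-fold composition of the relation $R$ with itself. $\mathbb{E}_0$ is the equivalence relation of eventual equality on $2^\omega$. $E_\Gamma^X$ is the orbit equivalence relation of $\Gamma$ on $X$. *)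

(* Defs.v *)
From mathcomp Require Import all_boot.
From mathcomp Require Import boolp classical_sets functions cardinality.
From mathcomp Require Import topology borel_hierarchy.

Set Implicit Arguments.
Unset Strict Implicit.
Unset Printing Implicit Defensive.

Local Open Scope classical_set_scope.

(* A strategy for player B in the strong Choquet game maps the nonempty list
   of player A's moves (U_0, x_0), ..., (U_n, x_n) to the answer V_n; B's own
   earlier answers are determined by it. *)
Definition choquet_strategy (T : Type) := seq (set T * T) -> set T.

Section StrongChoquet.
Context {T : topologicalType}.
Implicit Types (sigma : choquet_strategy T) (a : nat -> set T * T).

Definition choquet_answer sigma a (n : nat) : set T := sigma (mkseq a n.+1).

Definition choquet_legalA sigma a (n : nat) : Prop :=
  [/\ open (a n).1,
      (a n).1 `<=` (if n is m.+1 then choquet_answer sigma a m else setT) &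
      (a n).1 (a n).2].

Definition choquet_legalB sigma a (n : nat) : Prop :=
  [/\ open (choquet_answer sigma a n),
      choquet_answer sigma a n `<=` (a n).1 &
      choquet_answer sigma a n (a n).2].

(* B must answer legally as long as A has played legally, and must win every
   infinite run. *)
Definition choquet_winning sigma : Prop :=
  forall a,
    (forall n, (forall m, (m <= n)%N -> choquet_legalA sigma a m) ->
       choquet_legalB sigma a n) /\
    ((forall n, choquet_legalA sigma a n) ->
       \bigcap_n choquet_answer sigma a n !=set0).

End StrongChoquet.

Definition strong_choquet (T : topologicalType) : Prop :=
  exists sigma : choquet_strategy T, choquet_winning sigma.

Section HomeoGroups.
Context {X : topologicalType}.
Implicit Types (G D : set (X -> X)) (U Y F : set X).

Definition homeomorphism (f : X -> X) : Prop :=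
  exists g : X -> X, [/\ cancel f g, cancel g f, continuous f & continuous g].

Definition homeo_group G : Prop :=
  [/\ G `<=` homeomorphism,
      G id,
      forall f g, G f -> G g -> G (f \o g) &
      forall f, G f -> exists g, [/\ G g, cancel f g & cancel g f]].

Definition invariant_set G Y : Prop := forall g, G g -> g @` Y = Y.

Definition translates D U : set X := \bigcup_(g in D) g @` U.

Definition orbit_set G (x : X) : set X := [set g x | g in G].

Definition orbit_eq G (x y : X) : Prop := exists2 g, G g & g x = y.

Definition noncovering G Y : set (set X) :=
  [set U | open U /\
     ~ exists D, [/\ finite_set D, D `<=` G & Y `<=` translates D U]].

Definition small_sets (UU : set (set X)) : set (set X) :=
  [set F | forall U, UU U ->
     exists V, [/\ open V, F `<=` V & UU (V `|` U)]].

Definition positive_set (UU : set (set X)) F : Prop := ~ small_sets UU F.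

End HomeoGroups.

Definition E0 (y z : nat -> bool) : Prop :=
  exists n, forall m, (n <= m)%N -> y m = z m.

Definition pair_homomorphism (A B : Type) (E E' : A -> A -> Prop)
    (F F' : B -> B -> Prop) (f : A -> B) : Prop :=
  (forall c d, E c d -> F (f c) (f d)) /\
  (forall c d, E' c d -> F' (f c) (f d)).

(* Main.v *)
(* Call x in K heavy if all its neighbourhoods meet K in a positive set. The
   key point (separated_return) is that near a heavy point, for each n and each
   finite E, there are a heavy point x and g in G such that g x returns near x
   while (e x, e' (g x)) avoids R n for all e, e' in E. Iterating, one gets
   g_n in G and shrinking open sets W_n around heavy points x_n, with
   g_n (W_(n+1)) inside W_n, such that for the products g^y_n of the g_i with
   y i = true (i < n), the set phi y is the intersection of the g^y_n (W_n). At
   stage n the 2^n translates g^s_n (W_n, x_n) are played as moves in parallel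
   strong Choquet games, and W_(n+1) is taken inside all the answers pulled back
   to W_n, so phi y is nonempty. If X is compact, the x_n cluster in K at some x
   lying in all W_n, and any cluster point of (g^y_n x)_n lies in phi y and in
   the closure of the orbit of x. *)
Require Import Defs.
From mathcomp Require Import all_boot.
From mathcomp Require Import boolp classical_sets functions cardinality.
From mathcomp Require Import topology borel_hierarchy.

Local Open Scope classical_set_scope.

(** * Finite families, compactness and regularity *)

Lemma finite_set_ind {T : Type} (P : set T -> Prop) :
  P set0 -> (forall x A, P A -> P (x |` A)) ->
  forall A, finite_set A -> P A.
Proof.
move=> P0 PU A /(finite_seqP (T := {classic T}))[s ->].
elim: s => [|x s IHs]; first by rewrite classical_sets.set_nil.
suff -> : [set` x :: s] = x |` [set` s] by exact: PU.
by apply/seteqP; split=> y /=; rewrite in_cons => /predU1P.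
Qed.

Lemma finite_bigcap_filter {T I : Type} (F : set_system T) (D : set I)
  (f : I -> set T) : Filter F -> finite_set D ->
  (forall i, D i -> F (f i)) -> F (\bigcap_(i in D) f i).
Proof.
move=> FF; move: D; apply: finite_set_ind => [|i D IHD] Df.
  by rewrite bigcap_set0; exact: filterT.
rewrite bigcap_setU1; apply: filterI; first by apply: Df; left.
by apply: IHD => j Dj; apply: Df; right.
Qed.

Lemma finite_common_bound {I : Type} (D : set I) (P : I -> nat -> Prop) :
  (forall i m n, (m <= n)%N -> P i m -> P i n) -> finite_set D ->
  (forall i, D i -> exists n, P i n) ->
  exists n, forall i, D i -> P i n.
Proof.
move=> Pmono; move: D; apply: finite_set_ind => [|i D IHD] DP.
  by exists 0%N.
have [|n Pn] := IHD; first by move=> j Dj; apply: DP; right.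
have [m Pm] := DP i (or_introl erefl).
exists (maxn m n) => j [->|Dj].
- by apply: Pmono Pm; rewrite leq_maxl.
- by apply: Pmono (Pn _ Dj); rewrite leq_maxr.
Qed.

(** If [P K] failed, the sets whose complement in [K] satisfies [P] would form a proper filter
    containing [K]; the neighbourhood [W] of a cluster point would then have its complement in the
    filter. *)
Lemma compact_ind {T : topologicalType} (P : set T -> Prop) (K : set T) :
  compact K -> P set0 -> (forall A B, P A -> P B -> P (A `|` B)) ->
  (forall A B, A `<=` B -> P B -> P A) ->
  (forall x, K x -> exists2 W, nbhs x W & P (K `&` W)) -> P K.
Proof.
move=> Kcpt P0 PU PS Ploc; apply: contrapT => nPK.
pose F : set_system T := [set A | P (K `\` A)].
have FF : ProperFilter F.
  split; first by rewrite /F /= setD0.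
  split; first by rewrite /F /= setDT.
  - by move=> A B FA FB; rewrite /F /= setDIr; exact: PU.
  - by move=> A B AB; apply: PS; exact: setDS.
have [|x [Kx Fx]] := Kcpt F; first by rewrite /F /= setDv.
have [W xW PW] := Ploc x Kx.
have FW : F (~` W) by rewrite /F /= setDE setCK.
by have [y []] := Fx _ _ FW xW.
Qed.

Lemma regular_nbhs {T : topologicalType} (x : T) (A : set T) :
  regular_space T -> nbhs x A ->
  exists B, [/\ open B, B x & closure B `<=` A].
Proof.
move=> Treg /Treg[B xB BA]; exists B°; split; first exact: open_interior.
  exact: nbhs_singleton (nbhs_interior xB).
by apply: subset_trans BA; apply: closureS; exact: interior_subset.
Qed.

Lemma regular_compact {T : topologicalType} (K A : set T) :
  regular_space T -> compact K -> open A -> K `<=` A ->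
  exists B, [/\ open B, K `<=` B & closure B `<=` A].
Proof.
move=> Treg Kcpt Aop KA.
pose P C := exists B, [/\ open B, C `<=` B & closure B `<=` A].
apply: (@compact_ind _ P) => //.
- by exists set0; split => //; [exact: open0|rewrite closure0].
- move=> C D [B [Bo CB BA]] [B' [Bo' DB' BA']]; exists (B `|` B'); split.
  + exact: openU.
  + exact: setUSS.
  + by rewrite closureU subUset.
- by move=> C D CD [B [Bo DB BA]]; exists B; split => //; exact: subset_trans DB.
- move=> x Kx; have xA : nbhs x A by apply: open_nbhs_nbhs; split=> //; exact: KA.
  have [B [Bo Bx BA]] := regular_nbhs _ _ Treg xA.
  by exists B; [exact: open_nbhs_nbhs|exists B; split => //; exact: subIsetr].
Qed.

(** * Homeomorphism groups *)

Lemma can2_imageE {T U : Type} (f : T -> U) (g : U -> T) (A : set T) :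
  cancel f g -> cancel g f -> f @` A = g @^-1` A.
Proof.
move=> fK gK; apply/seteqP; split=> [_ [x Ax <-]|y gAy] /=; first by rewrite fK.
by exists (g y).
Qed.

Section HomeoGroup.
Context {X : topologicalType} {G : set (X -> X)} (G_group : homeo_group G).

Lemma homeo_group_id : G id. Proof. by case: G_group. Qed.

Lemma homeo_group_comp g h : G g -> G h -> G (g \o h).
Proof. by case: G_group => _ _ + _; exact. Qed.

Lemma homeo_group_inv g : G g -> exists h, [/\ G h, cancel g h & cancel h g].
Proof. by case: G_group => _ _ _; exact. Qed.

Lemma homeo_group_continuous g : G g -> continuous g.
Proof. by case: G_group => Gh _ _ _ /Gh[h []]. Qed.

Lemma homeo_group_open g A : G g -> open A -> open (g @` A).
Proof.
move=> /homeo_group_inv[h [Gh gK hK]] Aop; rewrite (can2_imageE _ _ _ gK hK).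
by apply: open_comp => // x _; exact: homeo_group_continuous.
Qed.

Lemma homeo_group_closed g A : G g -> closed A -> closed (g @` A).
Proof.
move=> /homeo_group_inv[h [Gh gK hK]] Acl; rewrite (can2_imageE _ _ _ gK hK).
by apply: preimage_closed => // x _; exact: homeo_group_continuous.
Qed.

Lemma homeo_group_nbhs g x A : G g -> nbhs (g x) A -> nbhs x (g @^-1` A).
Proof. by move=> /homeo_group_continuous; exact. Qed.

End HomeoGroup.

(** * Small and positive sets *)

Section SmallSets.
Context {X : topologicalType} (UU : set (set X)).

Lemma small_set0 : small_sets UU set0.
Proof. by move=> U UUU; exists set0; rewrite set0U; split => //; exact: open0. Qed.

Lemma small_setS (A B : set X) : A `<=` B -> small_sets UU B -> small_sets UU A.
Proof.
move=> AB sB U /sB[V [Vo BV VU]].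
by exists V; split => //; exact: subset_trans BV.
Qed.

Lemma small_setU (A B : set X) :
  small_sets UU A -> small_sets UU B -> small_sets UU (A `|` B).
Proof.
move=> sA sB U /sA[V [Vo AV /sB[W [Wo BW WVU]]]].
exists (W `|` V); split; first exact: openU.
  by rewrite (setUC W); exact: setUSS.
by rewrite -setUA.
Qed.

Definition heavy_point (K : set X) (x : X) : Prop :=
  K x /\ forall W, nbhs x W -> positive_set UU (K `&` W).

(** The points having a neighbourhood whose trace on [K] is small form an open set [N], and the
    heavy points in [C] are those outside [N]. *)
Lemma compact_heavy_points (K C : set X) :
  compact C -> C `<=` K -> compact (C `&` heavy_point K).
Proof.
move=> Ccpt CK.
pose N : set X := [set x | exists2 W, nbhs x W & small_sets UU (K `&` W)].
suff -> : C `&` heavy_point K = C `&` ~` N.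
  apply: compact_closedI => //; apply: open_closedC.
  rewrite openE => x [W /nbhs_interior xW sW].
  by apply: filterS xW => y yW; exists W.
apply/seteqP; split=> x [Cx].
  by move=> [_ hx]; split=> // -[W /hx].
move=> nNx; split=> //; split; first exact: CK.
by move=> W xW sW; apply: nNx; exists W.
Qed.

(* The light points of C form a relatively open set, each of whose compact
   subsets is small; so deleting them does not affect positivity. *)
Lemma positive_heavy_points (K C : set X) :
  compact C -> C `<=` K -> positive_set UU C ->
  positive_set UU (C `&` heavy_point K).
Proof.
move=> Ccpt CK Cpos sH; apply: Cpos => U /sH[V [Vo HV VU]].
have : small_sets UU (C `\` V).
  apply: (@compact_ind _ (small_sets UU)).
  - by rewrite setDE; apply: compact_closedI => //; exact: open_closedC.
  - exact: small_set0.
  - exact: small_setU.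
  - exact: small_setS.
  - move=> x [Cx nVx]; apply: contrapT => nW; apply: nVx; apply: HV; split=> //.
    split=> [|W xW sW]; first exact: CK.
    apply: nW; exists W => //; apply: small_setS sW.
    by apply: setSI => y [/CK].
(* Smallness of the remainder is applied to the enlarged set, the union of [V] and [U]. *)
move=> /(_ _ VU)[W [Wo CVW WVU]]; exists (W `|` V).
split; [exact: openU| |by rewrite -setUA].
by move=> x Cx; have [Vx|nVx] := pselect (V x); [right|left; exact: CVW].
Qed.

End SmallSets.

(** * Separated returns *)

Section Returns.
Context {X : topologicalType} {G : set (X -> X)} {Y K : set X}
  {R : nat -> set (X * X)}.
Context (X_regular : regular_space X) (G_group : homeo_group G)
  (Y_inv : invariant_set G Y)
  (R_incr : forall m n, (m <= n)%N -> R m `<=` R n)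
  (R_closed : forall n, closed (R n))
  (K_compact : compact K)
  (Ha : forall n x, K x ->
     exists2 g, G g & ~ (R n \; R n)%relation (x, g x))
  (Hb : forall g, G g -> exists n, forall x, K x -> R n (x, g x))
  (Hc : forall g x y n, G g -> translates G K x -> translates G K y ->
     R n (x, y) -> R n (g x, g y)).

Lemma translates_orbit (g : X -> X) (x : X) : G g -> K x -> translates G K (g x).
Proof. by move=> Gg Kx; exists g => //; exists x. Qed.

Lemma uniform_displacement (n : nat) (D : set (X -> X)) :
  finite_set D -> D `<=` G ->
  exists2 m, (n <= m)%N & forall g x, D g -> K x -> R m (x, g x).
Proof.
move=> Dfin DG.
have [|//|g /DG/Hb//|m Rm] := finite_common_bound D
    (fun g m => forall x, K x -> R m (x, g x)).
  by move=> g m m' mm' Rm x /Rm; exact: R_incr.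
exists (maxn m n); first exact: leq_maxr.
by move=> g x Dg Kx; apply: (R_incr m); [exact: leq_maxl|exact: Rm].
Qed.

(* If [Delta V1] and [Delta U] cover [Y] and no point of [F] returns suitably
   to [V], then every [x] in [F] has a neighbourhood moved by some [g x] off
   [Delta V1], so that points of [Y] in it lie in [g x^-1 Delta U]; compactness
   of [F] and the choice of [U] then make [Y] coverable by translates of [U]. *)
Lemma separated_return (F V : set X) (n : nat) (E : set (X -> X)) :
  compact F -> F `<=` K -> positive_set (noncovering G Y) F ->
  open V -> F `<=` V -> finite_set E -> E `<=` G ->
  exists x g, [/\ F x, G g, V (g x) &
    forall e e', E e -> E e' -> ~ R n (e x, e' (g x))].
Proof.
move=> Fcpt FK Fpos Vo FV Efin EG; apply: contrapT => noret.
have [V1 [V1o FV1 V1V]] := regular_compact _ _ X_regular Fcpt Vo FV.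
move/existsNP: Fpos => [U /not_implyP[UU nU]].
have covU W : open W -> F `<=` W ->
    exists D, [/\ finite_set D, D `<=` G & Y `<=` translates D (W `|` U)].
  move=> Wo FW; apply: contrapT => nD; apply: nU; exists W; split => //.
  by split => //; apply: openU => //; case: UU.
have [D [Dfin DG YD]] := covU _ V1o FV1.
have /choice[inv invP] : forall g, exists h, G g -> [/\ G h, cancel g h & cancel h g].
  move=> g; have [Gg|nGg] := pselect (G g); last by exists g.
  by have [h hP] := homeo_group_inv G_group _ Gg; exists h.
(* If [e x] and [e' (inv d (g x))] are related, (c) relates [d (inv e' (e x))] to [g x]; [H]
   collects the maps that take [x] to these intermediate points. *)
pose H := [set d.1 \o inv d.2.1 \o d.2.2 | d in D `*` (E `*` E)].
have Hfin : finite_set H by do !apply: finite_image => //; do ?apply: finite_setX.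
have HG : H `<=` G.
  move=> _ [[d [e e']] /= [Dd [Ee Ee']] <-].
  have [Gi _ _] := invP _ (EG _ Ee).
  apply: homeo_group_comp => //; last exact: EG.
  by apply: homeo_group_comp => //; exact: DG.
have [m nm Rm] := uniform_displacement n H Hfin HG.
(* Each element of [H] moves [x] by one [R m]-step, so a return of [inv d (g x)] to [V] would join
   [x] to [g x] by two [R m]-steps, against the choice of [g]. *)
have escape x : F x -> exists2 g, G g &
    forall d, D d -> ~ closure V1 (inv d (g x)).
  move=> Fx; have Kx := FK _ Fx; have [g Gg Rg] := Ha m x Kx.
  exists g => // d Dd V1x; apply: noret.
  have [Gi dK iK] := invP d (DG _ Dd).
  exists x, (inv d \o g); split=> //.
  - exact: homeo_group_comp.
  - exact: V1V.
  move=> e e' Ee Ee' Ree'; apply: Rg.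
  have [Gi' eK ieK] := invP e' (EG _ Ee').
  exists (d (inv e' (e x))) => /=.
    by apply: (Rm (d \o inv e' \o e)) => //; exists (d, (e', e)).
  have -> : g x = d (inv e' (e' (inv d (g x)))) by rewrite eK iK.
  apply: (R_incr n) => //.
  have Gdi : G (d \o inv e') by apply: homeo_group_comp => //; exact: DG.
  apply: (Hc (d \o inv e')) => //.
    by apply: translates_orbit => //; exact: EG.
  apply: (translates_orbit (e' \o inv d \o g)) => //.
  apply: homeo_group_comp => //.
  by apply: homeo_group_comp => //; exact: EG.
pose P A := exists W L, [/\ open W, A `<=` W, finite_set L, L `<=` G &
  W `&` Y `<=` translates L U].
have : P F.
  apply: (@compact_ind _ P) => //.
  - exists set0, set0; split=> //; first exact: open0.
    by rewrite set0I; exact: sub0set.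
  - move=> A B [W [L [Wo AW Lfin LG WL]]] [W' [L' [Wo' BW' Lfin' LG' WL']]].
    exists (W `|` W'), (L `|` L'); split.
    + exact: openU.
    + exact: setUSS.
    + by rewrite finite_setU.
    + by rewrite subUset.
    + rewrite setIUl => y [/WL|/WL'] [l Ll Uly]; exists l => //; [by left|by right].
  - move=> A B AB [W [L [Wo BW Lfin LG WL]]].
    by exists W, L; split => //; exact: subset_trans BW.
  - move=> x Fx; have [g Gg gV1] := escape x Fx.
    have [h [Gh gK hK]] := homeo_group_inv G_group _ Gg.
    (* On [W] the map [g] avoids every [d]-translate of [V1], so it sends points of [Y] in [W] into
       the translates of [U] by [D]. *)
    pose W := \bigcap_(d in D) (inv d \o g) @^-1` ~` closure V1.
    have xW : nbhs x W.
      apply: finite_bigcap_filter => // d Dd.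
      have [Gi _ _] := invP d (DG _ Dd).
      apply: (homeo_group_nbhs G_group); first exact: homeo_group_comp.
      apply: open_nbhs_nbhs; split; last exact: gV1.
      by apply: closed_openC; exact: closed_closure.
    exists W° ; first exact: nbhs_interior.
    exists W°, [set h \o d | d in D]; split => //.
    + exact: open_interior.
    + exact: finite_image.
    + by move=> _ [d Dd <-]; apply: homeo_group_comp => //; exact: DG.
    move=> y [/interior_subset Wy Yy].
    have /YD[d Dd [z V1Uz dzE]] : Y (g y) by rewrite -(Y_inv _ Gg); exists y.
    have [_ dK _] := invP d (DG _ Dd).
    exists (h \o d); first by exists d.
    exists z; last by rewrite /= dzE gK.
    case: V1Uz => // V1z; case: (Wy d Dd) => /=; rewrite -dzE dK.
    exact: subset_closure.
move=> [W [L [Wo FW Lfin LG WL]]].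
(* [D'] covers [Y] from [W] and [U], and [L] covers the part of [Y] in [W] from [U]; hence [D'] and
   the products of [D'] with [L] cover [Y] from [U] alone. *)
have [D' [D'fin D'G YD']] := covU _ Wo FW.
case: UU => _; apply.
exists (D' `|` [set d.1 \o d.2 | d in D' `*` L]); split.
- by rewrite finite_setU; split => //; apply: finite_image; exact: finite_setX.
- rewrite subUset; split => // _ [[d l] [/= D'd Ll] <-].
  by apply: homeo_group_comp => //; [exact: D'G|exact: LG].
move=> y Yy; have [d D'd [z [Wz|Uz] dzE]] := YD' _ Yy; last first.
  by exists d; [left|exists z].
have Yz : Y z.
  have [h [Gh dK hK]] := homeo_group_inv G_group _ (D'G _ D'd).
  by rewrite -(Y_inv _ Gh); exists y => //; rewrite -dzE dK.
have [l Ll [u Uu luE]] := WL z (conj Wz Yz).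
exists (d \o l); first by right; exists (d, l).
by exists u => //=; rewrite luE.
Qed.

(** The complement of [R n] is open and [E] is finite, so finitely many product neighbourhoods of
    [(x, x)] are intersected. *)
Lemma separated_nbhs (x : X) (n : nat) (g : X -> X) (E : set (X -> X)) :
  finite_set E -> E `<=` G -> G g ->
  (forall e e', E e -> E e' -> ~ R n (e x, e' (g x))) ->
  exists2 W, nbhs x W & forall p q e e', W p -> W q -> E e -> E e' ->
    ~ R n (e p, e' (g q)).
Proof.
move=> Efin EG Gg sep.
have : nbhs (x, x) (\bigcap_(e in E `*` E)
    [set pq | ~ R n (e.1 pq.1, e.2 (g pq.2))]).
  apply: finite_bigcap_filter; first exact: finite_setX.
  move=> [e e'] [/= Ee Ee'].
  have : nbhs (e x, e' (g x)) (~` R n).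
    apply: open_nbhs_nbhs; split; last exact: sep.
    exact: closed_openC.
  move=> [[A B] [/= nA nB] AB]; exists (e @^-1` A, (e' \o g) @^-1` B).
    split=> /=; apply: (homeo_group_nbhs G_group) => //; first exact: EG.
    by apply: homeo_group_comp => //; exact: EG.
  by move=> [p q] [/= Ap Bq]; apply: (AB (_, _)).
move=> [[A B] [/= nA nB] AB]; exists (A `&` B); first exact: filterI.
by move=> p q e e' [Ap _] [_ Bq] Ee Ee'; apply: (AB (p, q) _ (e, e')).
Qed.

(** [separated_return] is applied to the heavy points in a closed neighbourhood of [x0] inside [U].
    They form a positive set because [x0] is heavy, and the point found is heavy again, which
    permits iteration. *)
Lemma separated_return_nbhs (U : set X) (x0 : X) (n : nat) (E : set (X -> X)) :
  open U -> U x0 -> heavy_point (noncovering G Y) K x0 ->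
  finite_set E -> E `<=` G ->
  exists g W x,
    [/\ G g, heavy_point (noncovering G Y) K x, open W, W x &
     [/\ closure W `<=` U, g @` closure W `<=` U &
       forall p q e e', W p -> W q -> E e -> E e' -> ~ R n (e p, e' (g q))]].
Proof.
move=> Uo Ux0 [_ hx0] Efin EG.
have x0U : nbhs x0 U by exact: open_nbhs_nbhs.
have [A [Ao Ax0 AU]] := regular_nbhs _ _ X_regular x0U.
pose C := K `&` closure A.
have CK : C `<=` K by exact: subIsetl.
have Ccpt : compact C by apply: compact_closedI => //; exact: closed_closure.
have Cpos : positive_set (noncovering G Y) C.
  apply: hx0; apply: filterS (open_nbhs_nbhs (conj Ao Ax0)).
  exact: subset_closure.
pose F := C `&` heavy_point (noncovering G Y) K.
have FU : F `<=` U by move=> x [[_ /AU]].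
have [x [g [[Cx hx] Gg Ugx sep]]] : exists x g, [/\ F x, G g, U (g x) &
    forall e e', E e -> E e' -> ~ R n (e x, e' (g x))].
  apply: separated_return => //.
  - exact: compact_heavy_points.
  - by move=> x [/CK].
  - exact: positive_heavy_points.
have [N xN Nsep] := separated_nbhs x n g E Efin EG Gg sep.
have xB : nbhs x (N `&` (U `&` g @^-1` U)).
  apply: filterI => //; apply: filterI.
    by apply: open_nbhs_nbhs; split => //; exact: FU.
  by apply: (homeo_group_nbhs G_group) => //; exact: open_nbhs_nbhs.
have [W [Wo Wx WB]] := regular_nbhs _ _ X_regular xB.
exists g, W, x; split=> //; split.
- by move=> y /WB[_ []].
- by move=> _ [y /WB[_ [_ Ugy]] <-].
- move=> p q e e' /subset_closure/WB[Np _] /subset_closure/WB[Nq _].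
  exact: Nsep.
Qed.

End Returns.

(** * Simultaneous runs of the strong Choquet game *)

Lemma nat_dependent_choice {T : Type} (P : nat -> T -> Prop)
  (Q : nat -> T -> T -> Prop) (t0 : T) :
  P 0%N t0 -> (forall n t, P n t -> exists2 t', P n.+1 t' & Q n t t') ->
  exists f : nat -> T,
    f 0%N = t0 /\ forall n, P n (f n) /\ Q n (f n) (f n.+1).
Proof.
move=> P0 PQ.
have /choice[next nextP] : forall nt : nat * T, exists t',
    P nt.1 nt.2 -> P nt.1.+1 t' /\ Q nt.1 nt.2 t'.
  move=> [n t] /=; have [/PQ[t' Pt' Qt']|nP] := pselect (P n t); last by exists t.
  by exists t'.
pose f := fix f n := if n is m.+1 then next (m, f m) else t0.
have fP n : P n (f n) by elim: n => [//|n /(nextP (n, _))[]].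
by exists f; split=> // n; split; [exact: fP|have [] := nextP (n, _) (fP n)].
Qed.

(** The newest factor is innermost, so that each new factor acts near the base sets [W n] before the
    older ones carry the result away. *)
Fixpoint twist {X : Type} (g : nat -> X -> X) (y : nat -> bool) (n : nat) :
    X -> X :=
  if n is m.+1 then (if y m then twist g y m \o g m else twist g y m) else id.

Section Scheme.
Context {X : topologicalType} {G : set (X -> X)} {Y K : set X}
  {R : nat -> set (X * X)}.
Context (X_regular : regular_space X) (G_group : homeo_group G)
  (Y_inv : invariant_set G Y)
  (R_incr : forall m n, (m <= n)%N -> R m `<=` R n)
  (R_closed : forall n, closed (R n))
  (K_compact : compact K)
  (Ha : forall n x, K x ->
     exists2 g, G g & ~ (R n \; R n)%relation (x, g x))
  (Hb : forall g, G g -> exists n, forall x, K x -> R n (x, g x))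
  (Hc : forall g x y n, G g -> translates G K x -> translates G K y ->
     R n (x, y) -> R n (g x, g y)).
Context (sigma : choquet_strategy X) (sigma_win : choquet_winning sigma).

Lemma choquet_legalA_prefix (a b : nat -> set X * X) (n : nat) :
  mkseq a n.+1 = mkseq b n.+1 -> forall m, (m <= n)%N ->
  choquet_legalA sigma a m -> choquet_legalA sigma b m.
Proof.
move=> ab.
have abE i : (i <= n)%N -> a i = b i.
  by move=> lein; rewrite -(@nth_mkseq _ (a 0%N) a n.+1 i lein) ab nth_mkseq.
case=> [|m] mn; rewrite /choquet_legalA -abE //.
suff -> : choquet_answer sigma a m = choquet_answer sigma b m by [].
congr sigma; apply/eq_in_map => i; rewrite mem_iota add0n => /andP[_ im].
by apply: abE; rewrite -ltnS (leq_trans im) // ltnW.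
Qed.

(* A stage of the simultaneous construction of all [2 ^ n] runs of the game:
   the run along [s] has accumulated group element [r.1] and history [r.2], and
   its last move is the image under [r.1] of [(stage_set, stage_point)]. *)
Record stage := Stage {
  stage_map : X -> X;
  stage_set : set X;
  stage_point : X;
  stage_runs : set ((X -> X) * seq (set X * X)) }.

(** B's latest answers in all runs, pulled back to the untranslated copy: a next move inside this
    set continues every run legally. *)
Definition stage_reply (t : stage) : set X :=
  stage_set t `&` \bigcap_(r in stage_runs t) r.1 @^-1` sigma r.2.

(** The boolean is the next digit of the branch. *)
Definition extend_run (g : X -> X) (W : set X) (x : X)
    (rb : ((X -> X) * seq (set X * X)) * bool) : (X -> X) * seq (set X * X) :=
  let h := if rb.2 then rb.1.1 \o g else rb.1.1 in
  (h, rcons rb.1.2 (h @` W, h x)).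

(** The history is a prefix of an infinite sequence because [choquet_winning] speaks of such
    sequences; the entries after [n] are arbitrary. *)
Definition legal_run (n : nat) (W : set X) (x : X)
    (r : (X -> X) * seq (set X * X)) : Prop :=
  G r.1 /\ exists a, [/\ r.2 = mkseq a n.+1,
    forall m, (m <= n)%N -> choquet_legalA sigma a m &
    a n = (r.1 @` W, r.1 x)].

Definition valid_stage (n : nat) (t : stage) : Prop :=
  [/\ open (stage_set t), stage_set t (stage_point t),
      heavy_point (noncovering G Y) K (stage_point t),
      finite_set (stage_runs t) &
      forall r, stage_runs t r -> legal_run n (stage_set t) (stage_point t) r].

(** The inclusions are for closures so that branches become closed as well as G-delta. The last
    clause separates every run with digit [false] at [n] from every run with digit [true]. *)
Definition stage_step (n : nat) (t t' : stage) : Prop :=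
  [/\ G (stage_map t'), closure (stage_set t') `<=` stage_reply t,
      stage_map t' @` closure (stage_set t') `<=` stage_reply t,
      stage_runs t' = [set extend_run (stage_map t') (stage_set t')
                         (stage_point t') rb | rb in stage_runs t `*` setT] &
      forall p q r r', stage_set t' p -> stage_set t' q ->
        stage_runs t r -> stage_runs t r' ->
        ~ R n (r.1 p, r'.1 (stage_map t' q))].

Lemma stage_reply_open (n : nat) (t : stage) :
  valid_stage n t -> open (stage_reply t).
Proof.
move=> [Wo _ _ rfin rleg]; apply: openI => //; rewrite openE => x xr.
apply: finite_bigcap_filter => // r tr.
have [Gr [a [rE aleg _]]] := rleg _ tr.
have [so _ _] := (sigma_win a).1 n aleg.
apply: (homeo_group_nbhs G_group) => //; apply: open_nbhs_nbhs.
by rewrite rE; split => //; have := xr _ tr; rewrite /= rE.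
Qed.

Lemma stage_reply_point (n : nat) (t : stage) :
  valid_stage n t -> stage_reply t (stage_point t).
Proof.
move=> [_ Wx _ _ rleg]; split=> // r tr.
have [Gr [a [rE aleg an]]] := rleg _ tr.
by have [_ _] := (sigma_win a).1 n aleg; rewrite an /= rE.
Qed.

(** The new move must lie in B's last answer: for digit [false] this is the inclusion of [W] in the
    reply set, for digit [true] that of its image under [g]. *)
Lemma extend_run_legal (n : nat) (t : stage) (g : X -> X) (W : set X) (x : X) rb :
  valid_stage n t -> G g -> open W -> W x ->
  W `<=` stage_reply t -> g @` W `<=` stage_reply t ->
  stage_runs t rb.1 -> legal_run n.+1 W x (extend_run g W x rb).
Proof.
move=> [_ _ _ _ rleg] Gg Wo Wx Wt gWt; case: rb => -[r hist] b /= tr.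
have [/= Gr [a [histE aleg _]]] := rleg _ tr.
rewrite {hist}histE in tr *.
rewrite /extend_run /=; set h := if b then _ else _.
have Gh : G h by rewrite /h; case: b {h}; first exact: homeo_group_comp.
(* The new move stands at [n.+1] and is repeated afterwards as a filler. *)
split=> //=; pose a' i := if (i <= n)%N then a i else (h @` W, h x).
have a'E : mkseq a n.+1 = mkseq a' n.+1.
  apply/eq_in_map => i; rewrite mem_iota add0n => /andP[_ ilen].
  by rewrite /a' -ltnS ilen.
have a'n : a' n.+1 = (h @` W, h x) by rewrite /a' ltnn.
exists a'; split=> //; first by rewrite mkseqS -a'E a'n.
move=> m; rewrite leq_eqVlt => /predU1P[->|mn]; last first.
  exact: (choquet_legalA_prefix _ _ _ a'E _ mn (aleg _ mn)).
split; rewrite a'n /=; [exact: (homeo_group_open G_group)| |by exists x].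
rewrite /choquet_answer -a'E => _ [p Wp <-]; rewrite /h.
case: (b); last by have [_ tp] := Wt _ Wp; exact: (tp _ tr).
by have [|_ tgp] := gWt (g p); [exists p|exact: (tgp _ tr)].
Qed.

Lemma stage_extension (n : nat) (t : stage) :
  valid_stage n t -> exists2 t', valid_stage n.+1 t' & stage_step n t t'.
Proof.
move=> tP; have [_ _ hx rfin rleg] := tP.
have [||g [W [x [Gg hx' Wo Wx [WU gWU sep]]]]] :=
    separated_return_nbhs X_regular G_group Y_inv R_incr R_closed K_compact
    Ha Hb Hc (stage_reply t) _ n [set r.1 | r in stage_runs t]
    (stage_reply_open _ _ tP) (stage_reply_point _ _ tP) hx.
- exact: finite_image.
- by move=> _ [r /rleg[Gr _] <-].
exists (Stage g W x [set extend_run g W x rb | rb in stage_runs t `*` setT]).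
  split=> //=.
    by apply: finite_image; apply: finite_setX => //; exact: finite_finset.
  move=> _ [rb [/= tr _] <-]; apply: (extend_run_legal _ t) => //.
    by apply: subset_trans WU; exact: subset_closure.
  by apply: subset_trans gWU; apply: image_subset; exact: subset_closure.
split=> //= p q r r' Wp Wq tr tr'.
by apply: sep => //; [exists r|exists r'].
Qed.

Lemma separated_scheme : positive_set (noncovering G Y) K ->
  exists (g : nat -> X -> X) (W : nat -> set X) (x : nat -> X),
  [/\ forall n, [/\ G (g n), open (W n), K (x n) & W n (x n)],
      forall n, closure (W n.+1) `<=` W n,
      forall n, g n @` closure (W n.+1) `<=` W n,
      forall y, \bigcap_n twist g y n @` W n !=set0 &
      forall n y z p q, W n.+1 p -> W n.+1 q ->
        ~ R n (twist g y n p, twist g z n (g n q))].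
Proof.
move=> Kpos.
have [x0 [_ hx0]] : K `&` heavy_point (noncovering G Y) K !=set0.
  apply/set0P/eqP => H0.
  apply: (positive_heavy_points _ _ _ K_compact (@subset_refl _ K) Kpos).
  by rewrite H0; exact: small_set0.
(* A has already opened with the whole space, so the runs of stage [n] have [n.+1] moves but only
   [n] digits. *)
pose t0 := Stage id setT x0 [set (id, [:: (setT, x0)])].
have t0P : valid_stage 0%N t0.
  split=> //=; first exact: openT.
  move=> _ ->; split=> /=; first exact: homeo_group_id.
  exists (fun=> (setT, x0)); split=> //; last by rewrite image_id.
  by case=> // _; split=> //; exact: openT.
have [t [t0E tP]] := nat_dependent_choice _ _ t0 t0P stage_extension.
pose g n := stage_map (t n.+1).
pose W n := stage_set (t n).
pose x n := stage_point (t n).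
pose a y i := (twist g y i @` W i, twist g y i (x i)).
(* The finite prefixes of the infinite run [a y] are found among the runs of the stages, which makes
   the whole run legal. *)
have runP y n : stage_runs (t n) (twist g y n, mkseq (a y) n.+1).
  elim: n => [|n IHn]; first by rewrite /mkseq /a /W /x /= t0E /= image_id.
  have [_ [_ _ _ -> _]] := tP n.
  exists ((twist g y n, mkseq (a y) n.+1), y n) => //.
  by rewrite /extend_run /= (mkseqS _ n.+1).
have twG y n : G (twist g y n) by have [[_ _ _ _ /(_ _ (runP y n))[]]] := tP n.
have aleg y n : choquet_legalA sigma (a y) n.
  have [[_ _ _ _ /(_ _ (runP y n))[_ [b [/= abE bleg _]]]] _] := tP n.
  by apply: (choquet_legalA_prefix b _ n) => //; exact: bleg.
exists g, W, x; split.
- by move=> n; have [[Wo Wx [Kx _] _ _] [Gg _ _ _ _]] := tP n; split.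
- by move=> n p; have [_ [_ + _ _ _]] := tP n => /[apply] -[].
- by move=> n p; have [_ [_ _ + _ _]] := tP n => /[apply] -[].
(* A point in all of B's answers lies in all of A's moves, the translates of the [W n]. *)
- move=> y; have [p pP] := (sigma_win (a y)).2 (aleg y).
  exists p => n _; have [_ sub _] := (sigma_win (a y)).1 n (fun m _ => aleg y m).
  by apply: sub; exact: pP.
- move=> n y z p q Wp Wq; have [_ [_ _ _ _ sep]] := tP n.
  exact: (sep p q _ _ Wp Wq (runP y n) (runP z n)).
Qed.

End Scheme.

(** * Branches of the scheme *)

Lemma E0_sym (c d : nat -> bool) : E0 c d -> E0 d c.
Proof. by move=> [n cd]; exists n => m nm; rewrite cd. Qed.

Lemma E0_trans (b c d : nat -> bool) : E0 b c -> E0 c d -> E0 b d.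
Proof.
move=> [m bc] [n cd]; exists (maxn m n) => k; rewrite geq_max => /andP[mk nk].
by rewrite bc // cd.
Qed.

(** One point is chosen in the set of a representative of each class and carried by group elements
    to the other sets of the class. *)
Lemma E0_orbit_selection {X : topologicalType} (G : set (X -> X))
  (phi : (nat -> bool) -> set X) : homeo_group G ->
  (forall y, phi y !=set0) ->
  (forall y z, E0 z y -> exists2 g, G g & g @` phi z = phi y) ->
  exists f : (nat -> bool) -> X, (forall c, phi c (f c)) /\
    forall c d, E0 c d -> orbit_eq G (f c) (f d).
Proof.
move=> G_group phi0 phiE.
have /choice[rep repP] : forall Q : set (nat -> bool), exists z, Q !=set0 -> Q z.
  move=> Q; have [[z Qz]|nQ] := pselect (Q !=set0); first by exists z.
  by exists (fun=> false).
have /choice[p pP] := phi0.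
pose r c := rep (E0^~ c).
have rE c : E0 (r c) c by apply: (repP (E0^~ c)); exists c; exists 0%N.
(* [rep] takes the whole class as argument, and equivalent sequences have equal classes. *)
have rcd c d : E0 c d -> r c = r d.
  move=> cd; congr rep; apply/seteqP; split=> z zc; first exact: (E0_trans z c d zc cd).
  exact: (E0_trans z d c zc (E0_sym _ _ cd)).
have /choice[g gP] : forall c, exists g, G g /\ g @` phi (r c) = phi c.
  by move=> c; have [g Gg gE] := phiE _ _ (rE c); exists g.
exists (fun c => g c (p (r c))); split=> [c|c d cd].
  by have [_ <-] := gP c; exists (p (r c)).
have [[Gc _] [Gd _]] := (gP c, gP d).
have [h [Gh gK _]] := homeo_group_inv G_group _ Gc.
exists (g d \o h); first exact: homeo_group_comp.
by rewrite /= gK (rcd _ _ cd).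
Qed.

Section Branches.
Context {X : topologicalType} {G : set (X -> X)} {R : nat -> set (X * X)}.
Context (G_group : homeo_group G)
  (R_incr : forall m n, (m <= n)%N -> R m `<=` R n)
  (R_sym : forall n x y, R n (x, y) -> R n (y, x)).
Context (g : nat -> X -> X) (W : nat -> set X)
  (Gg : forall n, G (g n)) (Wo : forall n, open (W n))
  (clW : forall n, closure (W n.+1) `<=` W n)
  (gclW : forall n, g n @` closure (W n.+1) `<=` W n)
  (sep : forall n y z p q, W n.+1 p -> W n.+1 q ->
     ~ R n (twist g y n p, twist g z n (g n q))).

Definition branch (y : nat -> bool) : set X := \bigcap_n twist g y n @` W n.

Lemma twist_group y n : G (twist g y n).
Proof.
elim: n => [|n IHn] /=; first exact: homeo_group_id.
by case: ifP => // _; exact: homeo_group_comp.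
Qed.

Lemma twist_closure_step y n :
  twist g y n.+1 @` closure (W n.+1) `<=` twist g y n @` W n.
Proof.
move=> _ [p Wp <-] /=; case: ifP => _; last by exists p => //; exact: clW.
by exists (g n p) => //; apply: gclW; exists p.
Qed.

Lemma twist_decreasing y m n : (m <= n)%N ->
  twist g y n @` W n `<=` twist g y m @` W m.
Proof.
elim: n => [|n IHn]; first by rewrite leqn0 => /eqP->.
rewrite leq_eqVlt => /predU1P[->//|/IHn]; apply: subset_trans.
apply: subset_trans (twist_closure_step y n).
by apply: image_subset; exact: subset_closure.
Qed.

(** Passing to closures costs one index, which the intersection absorbs. *)
Lemma branch_closureE y : branch y = \bigcap_n twist g y n @` closure (W n).
Proof.
apply/seteqP; split=> p yp n _.
  by have [q Wq <-] := yp n I; exists q => //; exact: subset_closure.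
exact: (twist_closure_step y n p (yp n.+1 I)).
Qed.

Lemma branch_closed y : closed (branch y).
Proof.
rewrite branch_closureE; apply: closed_bigI => n _.
apply: (homeo_group_closed G_group); first exact: twist_group.
exact: closed_closure.
Qed.

Lemma branch_Gdelta y : Gdelta (branch y).
Proof.
exists (fun n => twist g y n @` W n) => // n.
by apply: (homeo_group_open G_group) => //; exact: twist_group.
Qed.

(** From [n] on both twists acquire the same innermost factors, so [h] still matches them at later
    indices; the sets decrease, so later indices suffice. *)
Lemma branch_translate h n y z :
  (forall m, (n <= m)%N -> z m = y m) ->
  (forall p, h (twist g z n p) = twist g y n p) ->
  h @` branch z `<=` branch y.
Proof.
move=> zy hn.
have hm m p : (n <= m)%N -> h (twist g z m p) = twist g y m p.
  elim: m p => [|m IHm] p; first by rewrite leqn0 => /eqP n0; move: hn; rewrite n0.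
  rewrite leq_eqVlt => /predU1P[<-//|nm] /=.
  by rewrite zy //; case: (y m) => /=; rewrite IHm.
move=> _ [p zp <-] m _; apply: (twist_decreasing y _ _ (leq_maxl m n)).
have [q Wq <-] := zp (maxn m n) I; exists q => //.
by rewrite hm // leq_maxr.
Qed.

Lemma branch_E0 y z : E0 z y -> exists2 h, G h & h @` branch z = branch y.
Proof.
move=> [n zy].
have [z' [Gz' zK z'K]] := homeo_group_inv G_group _ (twist_group z n).
have [y' [Gy' yK y'K]] := homeo_group_inv G_group _ (twist_group y n).
exists (twist g y n \o z').
  by apply: homeo_group_comp => //; exact: twist_group.
apply/seteqP; split.
  by apply: (branch_translate _ n) => // p /=; rewrite zK.
move=> p yp; exists (twist g z n (y' p)); last by rewrite /= zK y'K.
have /(_ _ (imageP _ yp)) // : (twist g z n \o y') @` branch y `<=` branch z.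
apply: (branch_translate _ n) => [m nm|q /=]; first by rewrite zy.
by rewrite yK.
Qed.

(** A pair in [R N] is in [R m] for all [m >= N]. If the digits at [m] differed, exactly one point
    would pass through [g m], which [sep] forbids, up to symmetry; so the sequences would agree from
    [N] on. *)
Lemma branch_separated y z :
  ~ E0 z y -> branch y `*` branch z `<=` ~` \bigcup_n R n.
Proof.
move=> nzy [p q] [/= yp zq] [N _ RN]; apply: nzy; exists N => m Nm.
have Rm := R_incr _ _ Nm _ RN.
have [p' Wp' pE] := yp m.+1 I; have [q' Wq' qE] := zq m.+1 I.
move: pE qE => /=; case: (y m); case: (z m) => //= pE qE; exfalso.
- by apply: (sep m z y q' p') => //; rewrite qE -pE in Rm *; exact: R_sym.
- by apply: (sep m y z p' q') => //; rewrite pE qE.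
Qed.

Lemma orbit_closure_invariant x h :
  G h -> h @` closure (orbit_set G x) `<=` closure (orbit_set G x).
Proof.
move=> Gh _ [p xp <-] A /(homeo_group_nbhs G_group _ _ _ Gh) /xp[q [[k Gk <-] Aq]].
by exists (h (k x)); split => //; exists (h \o k) => //; exact: homeo_group_comp.
Qed.

Lemma branch_orbit_closure y x : compact [set: X] -> (forall n, W n x) ->
  branch y `&` closure (orbit_set G x) !=set0.
Proof.
move=> Xcpt Wx; pose u n := twist g y n x.
have [|p [_ pu]] := Xcpt (u @ \oo) _; first exact: filterT.
have inP A : closed A -> (\forall n \near \oo, A (u n)) -> A p.
  by move=> Acl uA; apply: Acl => B /(pu _ _ uA)[q [? ?]]; exists q.
exists p; split.
  rewrite branch_closureE => n _; apply: inP.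
    apply: (homeo_group_closed G_group); first exact: twist_group.
    exact: closed_closure.
  exists n => // m /= nm.
  apply: (@image_subset _ _ (twist g y n) _ _ (@subset_closure _ (W n))).
  by apply: (twist_decreasing y _ _ nm); exists x.
apply: inP; first exact: closed_closure.
exists 0%N => // m _; apply: subset_closure.
by exists (twist g y m) => //; exact: twist_group.
Qed.

End Branches.

(** * Limit points of the scheme and the resulting homomorphisms *)

Lemma compact_decreasing_limit {X : topologicalType} (K : set X)
  (W : nat -> set X) (x : nat -> X) :
  compact K -> (forall n, closure (W n.+1) `<=` W n) ->
  (forall n, K (x n) /\ W n (x n)) -> exists2 p, K p & forall n, W n p.
Proof.
move=> Kcpt clW xP.
have WS m n : (m <= n)%N -> W n `<=` W m.
  elim: n => [|n IHn]; first by rewrite leqn0 => /eqP->.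
  rewrite leq_eqVlt => /predU1P[->//|/IHn]; apply: subset_trans.
  by apply: subset_trans (clW n); exact: subset_closure.
have [|p [Kp px]] := Kcpt (x @ \oo) _; first by exists 0%N => // n _; case: (xP n).
(* The points [x m] with [m > n] lie in [W n.+1], so [p] is in its closure and hence in [W n]. *)
exists p => // n; apply: clW => A /(px (W n.+1)); apply.
by exists n.+1 => // m /= nm; apply: (WS _ _ nm); case: (xP m).
Qed.

Theorem theorem2p19 (X : topologicalType)
  (X_regular : regular_space X)
  (X_choquet : strong_choquet X)
  (G : set (X -> X)) (G_group : homeo_group G)
  (Y : set X) (Y_inv : invariant_set G Y)
  (R : nat -> set (X * X))
  (R_incr : forall m n, (m <= n)%N -> R m `<=` R n)
  (R_refl : forall n x, R n (x, x))
  (R_sym : forall n x y, R n (x, y) -> R n (y, x))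
  (R_closed : forall n, closed (R n))
  (K : set X) (K_compact : compact K)
  (K_positive : positive_set (noncovering G Y) K)
  (Ha : forall n x, K x ->
     exists2 g, G g & ~ (R n \; R n)%relation (x, g x))
  (Hb : forall g, G g -> exists n, forall x, K x -> R n (x, g x))
  (Hc : forall g x y n, G g -> translates G K x -> translates G K y ->
     R n (x, y) -> R n (g x, g y)) :
  [/\ exists phi : (nat -> bool) -> set X,
        forall y z : nat -> bool,
          [/\ [/\ phi y !=set0, closed (phi y) & Gdelta (phi y)],
              E0 z y -> exists2 g, G g & g @` phi z = phi y &
              ~ E0 z y -> phi y `*` phi z `<=` ~` (\bigcup_n R n)],
      exists phi' : (nat -> bool) -> X,
        pair_homomorphism E0 (fun c d => ~ E0 c d)
          (orbit_eq G) (fun x y => ~ (\bigcup_n R n) (x, y)) phi' &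
      compact [set: X] ->
        exists2 x, K x &
          exists2 phi' : (nat -> bool) -> X,
            pair_homomorphism E0 (fun c d => ~ E0 c d)
              (orbit_eq G) (fun u v => ~ (\bigcup_n R n) (u, v)) phi' &
            forall c, closure (orbit_set G x) (phi' c)].
Proof.
have [sigma sigma_win] := X_choquet.
have [g [W [x [gWx clW gclW W0 sep]]]] := separated_scheme X_regular G_group
  Y_inv R_incr R_closed K_compact Ha Hb Hc sigma sigma_win K_positive.
have Gg n : G (g n) by case: (gWx n).
have Wo n : open (W n) by case: (gWx n).
pose phi := branch g W.
have phiE0 y z : E0 z y -> exists2 h, G h & h @` phi z = phi y.
  exact: branch_E0.
have phi_sep y z : ~ E0 z y -> phi y `*` phi z `<=` ~` (\bigcup_n R n).
  exact: branch_separated.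
have homP f : (forall c, phi c (f c)) ->
    (forall c d, E0 c d -> orbit_eq G (f c) (f d)) ->
    pair_homomorphism E0 (fun c d => ~ E0 c d)
      (orbit_eq G) (fun x y => ~ (\bigcup_n R n) (x, y)) f.
  move=> fphi fE; split=> // c d ncd; apply: (phi_sep c d) => //.
  by move/E0_sym.
split.
- exists phi => y z; split; [|exact: phiE0|exact: phi_sep].
  split; [exact: W0|exact: (branch_closed G_group)|].
  exact: (branch_Gdelta G_group).
- have [f [fphi fE]] := E0_orbit_selection G phi G_group W0 phiE0.
  by exists f; exact: homP.
- move=> Xcpt.
  have [|p Kp Wp] := compact_decreasing_limit _ W x K_compact clW.
    by move=> n; case: (gWx n).
  (* [Z] is invariant under [G], so the traces of the branches on [Z] are carried to each other like
     the branches, and the selection can be made inside [Z]. *)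
  pose Z := closure (orbit_set G p).
  have [||f [fphi fE]] := E0_orbit_selection G (fun y => phi y `&` Z) G_group.
  + by move=> y; exact: (branch_orbit_closure G_group).
  + move=> y z /phiE0[h Gh hphi]; exists h => //.
    have [k [Gk hK kK]] := homeo_group_inv G_group _ Gh.
    apply/seteqP; split=> [_ [q [zq Zq] <-]|q [yq Zq]].
      split; first by rewrite -hphi; exists q.
      by apply: (orbit_closure_invariant G_group _ _ Gh); exists q.
    exists (k q) => //; split.
      by move: yq; rewrite -hphi => -[r zr <-]; rewrite hK.
    by apply: (orbit_closure_invariant G_group _ _ Gk); exists q.
  exists p => //; exists f; last by move=> c; have [] := fphi c.
  by apply: homP => // c; have [] := fphi c.
Qed.
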